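(* Let $k\ge 1$ be an integer. The subRiemannian manifold $J^k$ does not have periodic geodesics; that is, there are no geodesic $\gamma:\mathbb{R}\to J^k$ and $T>0$ such that $\gamma(t+T)=\gamma(t)$ for all $t\in\mathbb{R}$.
   Context: $J^k$, the space of $k$-jets of a real function of one real variable, is identified with $\mathbb{R}^{k+2}$ with global coordinates $(x,\theta_0,\dots,\theta_k)$. It carries the rank 2 distribution $D\subset TJ^k$ defined by the $k$ Pfaffian equations $d\theta_i-\frac{1}{i!}x^i\,d\theta_0=0$, $i=1,\dots,k$. This distribution is globally framed by $$X_1=\frac{\partial}{\partial x},\qquad X_2=\sum_{i=0}^k\frac{x^i}{i!}\frac{\partial}{\partial\theta_i}.$$ The subRiemannian structure on $J^k$ is the one for which $X_1,X_2$ are orthonormal (equivalently, the metric on $D$ is the restriction of $dx^2+d\theta_0^2$). Let $(p,q)=(p_x,p_{\theta_0},\dots,p_{\theta_k},x,\theta_0,\dots,\theta_k)$ be the canonical coordinates on $T^*J^k$. The Hamiltonian of the geodesic flow is $$H_{sR}(p,q)=\frac12 p_x^2+\frac12\Big(\sum_{i=0}^k p_{\theta_i}\frac{x^i}{i!}\Big)^2.$$ A geodesic is the projection $\gamma(t)$ to $J^k$ of a solution $(p(t),\gamma(t))$ of Hamilton's equations for $H_{sR}$ with energy $H_{sR}=\frac12$. The condition $H_{sR}=\frac12$ means that $\gamma$ is parameterized by arc-length; in particular, constant curves are not geodesics. *)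

(* Defs.v *)
From HB Require Import structures.
From mathcomp Require Import all_boot all_order all_algebra.
From mathcomp Require Import all_classical all_reals all_analysis.

Set Implicit Arguments.
Unset Strict Implicit.
Unset Printing Implicit Defensive.

Import Order.TTheory GRing.Theory Num.Theory.
Import numFieldNormedType.Exports.

Local Open Scope ring_scope.

(* Points of J^k (and momenta) are row vectors in the global coordinates
   (x, theta_0, ..., theta_k). *)
Definition Jet (R : realType) (k : nat) := 'rV[R]_(k.+2).

Definition xcoord (R : realType) (k : nat) (v : 'rV[R]_(k.+2)) : R := v 0 ord0.

Definition thcoord (R : realType) (k : nat) (v : 'rV[R]_(k.+2))
  (i : 'I_k.+1) : R := v 0 (lift ord0 i).

(* Half the sum of the squares of the momentum functions of the orthonormal
   frame X_1 = d/dx, X_2 = \sum_i (x^i / i!) d/dtheta_i. *)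
Definition HsR (R : realType) (k : nat) (p q : 'rV[R]_(k.+2)) : R :=
  2^-1 * xcoord p ^+ 2 +
  2^-1 * (\sum_(i < k.+1) thcoord p i * (xcoord q ^+ i / i`!%:R)) ^+ 2.

Definition partial (R : realType) (n : nat) (f : 'rV[R]_n.+1 -> R) (j : 'I_n.+1)
  (v : 'rV[R]_n.+1) : R := 'D_(delta_mx 0 j) f v.

(* q' = dH/dp and p' = - dH/dq at all times. *)
Definition Hamilton_equations (R : realType) (n : nat)
    (H : 'rV[R]_n.+1 -> 'rV[R]_n.+1 -> R) (p q : R -> 'rV[R]_n.+1) : Prop :=
  forall (t : R) (j : 'I_n.+1),
    is_derive t 1 (fun s => q s 0 j) (partial (fun p' => H p' (q t)) j (p t)) /\
    is_derive t 1 (fun s => p s 0 j) (- partial (H (p t)) j (q t)).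

Definition is_geodesic (R : realType) (k : nat) (gamma : R -> Jet R k) : Prop :=
  exists p : R -> 'rV[R]_(k.+2),
    Hamilton_equations (@HsR R k) p gamma /\
    forall t, HsR (p t) (gamma t) = 2^-1.

(* Main.v *)
Require Import Defs.
From mathcomp Require Import all_boot all_order all_algebra.
From mathcomp Require Import all_classical all_reals all_analysis.
From mathcomp Require Import ring.

Set Implicit Arguments.
Unset Strict Implicit.
Unset Printing Implicit Defensive.

Import Order.TTheory GRing.Theory Num.Theory.
Import numFieldNormedType.Exports.
Local Open Scope ring_scope.

(** Write [a_i] for the momenta conjugate to the [theta_i] and [F t] for the
    momentum of the frame vector [X_2] along the trajectory, which is the value
    at [x t] of the polynomial with coefficients [a_i / i!].  The Hamiltonian
    does not involve the [theta_i], so the [a_i] are constants of motion, while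
    [theta_i' = F x^i / i!].  Hence the linear function
    [\sum_i a_i theta_i] of the position has derivative [F^2] along the geodesic
    ([is_derive_momentum_pairing]).
    If the geodesic is periodic, this function is both nondecreasing and
    periodic, hence constant, and [F] vanishes identically
    ([periodic_derive_ge0_eq0]).
    The energy condition then reads [p_x^2 = 1] at all times.
    But [p_x = x'], and by Rolle's theorem the periodic function [x] has a
    critical point: a contradiction. *)

Lemma derive_along_line (R : realType) (V W : normedModType R) (f : V -> W)
    (v a : V) :
  'D_v f a = 'D_1 (fun h : R => f (h *: v + a)) 0.
Proof.
rewrite /derive; under [in RHS]eq_fun => h do
  rewrite /= scale0r add0r addr0 [h *: 1]mulr1.
by [].
Qed.

(** Being nondecreasing, [f] lies between its equal values at the two ends of
    any interval of length [T], so it is constant there; centring that interval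
    at [t] puts [t] in its interior. *)
Lemma periodic_derive_ge0_eq0 (R : realType) (f df : R -> R) (T : R) :
    (forall t : R, is_derive t 1 f (df t)) -> (forall t, 0 <= df t) ->
    0 < T -> (forall t, f (t + T) = f t) ->
  forall t, df t = 0.
Proof.
move=> dfP df0 T0 fT t.
have T2 : 0 < T / 2 by rewrite divr_gt0.
have ndf x y : x <= y -> f x <= f y.
  move=> xy; apply: (@ger0_derive1_ndecr _ f x y) => //.
  - by move=> z _; rewrite derive1E (@derive_val _ _ _ _ _ _ _ (dfP z)).
  - by apply: derivable_within_continuous => z _; have [] := dfP z.
have fcst : \forall s \near t, f s = cst (f (t - T / 2)) s.
  near=> s; have /andP[ts st] : t - T / 2 < s < t + T / 2.
    by apply/andP; split; near: s; [apply: lt_nbhsr|apply: lt_nbhsl];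
      rewrite ?ltrBlDr ltrDl.
  apply/le_anti/andP; split; last exact/ndf/ltW.
  by rewrite /= -[leRHS]fT; apply: ndf; rewrite {2}(splitr T) addrA subrK ltW.
rewrite -(@derive_val _ _ _ _ _ _ _ (dfP t)) (near_eq_derive _ fcst).
exact: derive_cst.
Unshelve. all: by end_near. Qed.

Section GeodesicFlow.
Variables (R : realType) (k : nat).
Implicit Types p q : 'rV[R]_(k.+2).

Definition X2_momentum p q : R :=
  \sum_(i < k.+1) thcoord p i * (xcoord q ^+ i / i`!%:R).

Lemma xcoord_line h (j : 'I_k.+2) p :
  xcoord (h *: delta_mx 0 j + p) = h * (j == ord0)%:R + xcoord p.
Proof. by rewrite /xcoord !mxE eqxx /= eq_sym. Qed.

Lemma thcoord_line h (j : 'I_k.+2) p i :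
  thcoord (h *: delta_mx 0 j + p) i = h * (j == lift ord0 i)%:R + thcoord p i.
Proof. by rewrite /thcoord !mxE eqxx /= eq_sym. Qed.

Lemma X2_momentum_line_x h p q :
  X2_momentum (h *: delta_mx 0 ord0 + p) q = X2_momentum p q.
Proof. by apply: eq_bigr => i _; rewrite thcoord_line mulr0 add0r. Qed.

Lemma X2_momentum_line_th h j p q :
  X2_momentum (h *: delta_mx 0 (lift ord0 j) + p) q =
  h * (xcoord q ^+ j / j`!%:R) + X2_momentum p q.
Proof.
rewrite /X2_momentum (bigD1 j) //= [in RHS](bigD1 j) //= thcoord_line eqxx.
rewrite mulr1 mulrDl -addrA; congr (_ + (_ + _)).
apply: eq_bigr => i ij; rewrite thcoord_line (inj_eq lift_inj).
by rewrite eq_sym (negbTE ij) mulr0 add0r.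
Qed.

(** As a function of one momentum coordinate, [HsR] is half the square of an
    affine function plus a constant: [p_x] enters only the first square, each
    [a_i] only the second. *)
Lemma derive_half_square_affine (f : R -> R) (b c d : R) :
  (forall h, f h = d + 2^-1 * (h * b + c) ^+ 2) -> 'D_1 f 0 = c * b.
Proof.
move=> fE; have -> : f = cst d + 2^-1 \*: ((b \*: id + cst c) ^+ 2).
  by apply/funext => h; rewrite fE !fctE /GRing.scale /= [h * b]mulrC.
by rewrite derive_val !fctE /GRing.scale /=; field.
Qed.

Lemma partial_HsR_px p q :
  partial (fun p' => HsR p' q) ord0 p = xcoord p.
Proof.
rewrite /partial derive_along_line -[RHS]mulr1.
apply: (@derive_half_square_affine _ _ _ (2^-1 * X2_momentum p q ^+ 2)) => h.
by rewrite /HsR -!/(X2_momentum _ _) X2_momentum_line_x xcoord_line addrC.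
Qed.

Lemma partial_HsR_pth p q j :
  partial (fun p' => HsR p' q) (lift ord0 j) p =
  X2_momentum p q * (xcoord q ^+ j / j`!%:R).
Proof.
rewrite /partial derive_along_line.
apply: (@derive_half_square_affine _ _ _ (2^-1 * xcoord p ^+ 2)) => h.
by rewrite /HsR -!/(X2_momentum _ _) X2_momentum_line_th xcoord_line mulr0 add0r.
Qed.

Lemma partial_HsR_th p q j : partial (HsR p) (lift ord0 j) q = 0.
Proof.
rewrite /partial derive_along_line.
have -> : (fun h : R => HsR p (h *: delta_mx 0 (lift ord0 j) + q)) =
    cst (HsR p q).
  by apply/funext => h; rewrite /HsR xcoord_line mulr0 add0r.
exact: derive_cst.
Qed.

Variables p gamma : R -> 'rV[R]_(k.+2).
Hypothesis pgammaH : Hamilton_equations (@HsR R k) p gamma.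

Lemma is_derive_xcoord (t : R) :
  is_derive t 1 (fun s => xcoord (gamma s)) (xcoord (p t)).
Proof. by have [+ _] := pgammaH t ord0; rewrite partial_HsR_px. Qed.

Lemma is_derive_thcoord (t : R) i :
  is_derive t 1 (fun s => thcoord (gamma s) i)
    (X2_momentum (p t) (gamma t) * (xcoord (gamma t) ^+ i / i`!%:R)).
Proof. by have [+ _] := pgammaH t (lift ord0 i); rewrite partial_HsR_pth. Qed.

Lemma thmomentum_constant t i : thcoord (p t) i = thcoord (p 0) i.
Proof.
apply: (@is_derive_0_is_cst _ (fun s => thcoord (p s) i)) => s.
by have [_] := pgammaH s (lift ord0 i); rewrite partial_HsR_th oppr0.
Qed.

(** Weighting [theta_i' = F x^i / i!] by the constant [a_i] and summing
    reproduces the polynomial that defines [F], which gives the factor [F] a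
    second time. *)
Lemma is_derive_momentum_pairing (t : R) :
  is_derive t 1 (fun s => \sum_(i < k.+1) thcoord (p 0) i * thcoord (gamma s) i)
    (X2_momentum (p t) (gamma t) ^+ 2).
Proof.
have -> : (fun s => \sum_(i < k.+1) thcoord (p 0) i * thcoord (gamma s) i) =
    \sum_(i < k.+1) (thcoord (p 0) i \*: (fun s => thcoord (gamma s) i)).
  by apply/funext => s; rewrite fct_sumE.
apply: is_derive_eq.
  by apply: is_derive_sum => i; apply/is_deriveZ/is_derive_thcoord.
rewrite expr2 {2}/X2_momentum mulr_sumr; apply: eq_bigr => i _.
by rewrite thmomentum_constant /GRing.scale /= mulrCA.
Qed.

End GeodesicFlow.

Theorem theorem1 (R : realType) (k : nat) (hk : (1 <= k)%N) :
  ~ exists (gamma : R -> Jet R k) (T : R),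
      [/\ is_geodesic gamma, 0 < T & forall t : R, gamma (t + T) = gamma t].
Proof.
move=> [gamma [T [[p [pgammaH energy]] T0 gammaT]]].
have F0 t : X2_momentum (p t) (gamma t) = 0.
  apply/eqP; rewrite -sqrf_eq0; apply/eqP; move: t.
  apply: (periodic_derive_ge0_eq0 (is_derive_momentum_pairing pgammaH) _ T0) =>
    // t.
    exact: sqr_ge0.
  by rewrite gammaT.
have dx := is_derive_xcoord pgammaH.
have [|||c _ dx0] := @Rolle R (fun s => xcoord (gamma s)) 0 T T0.
- by move=> s _; have [] := dx s.
- by apply: derivable_within_continuous => s _; have [] := dx s.
- by rewrite -[T]add0r gammaT.
have px0 : xcoord (p c) = 0.
  by rewrite -(@derive_val _ _ _ _ _ _ _ (dx c)) (@derive_val _ _ _ _ _ _ _ dx0).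
have := energy c; rewrite /HsR -/(X2_momentum _ _) F0 px0.
by rewrite expr0n /= !mulr0 addr0 => /esym/eqP; rewrite invr_eq0 pnatr_eq0.
Qed.
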